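(* Let $\gamma$ be a convex smooth closed curve in the Lorentz plane with metric $dx\,dy$. Let $P_1,\dots,P_{2n}\in\gamma$ be the consecutive reflection points of a periodic light-like billiard trajectory inside $\gamma$, and let $t_i$ be the slope of $\gamma$ at $P_i$. Suppose the billiard ball starts at $P_1$ with horizontal velocity $(1,0)$, and let $(v,0)$ be its velocity when it has returned to $P_1$ after traversing the whole periodic trajectory. Then $$v=\frac{t_2t_4\cdots t_{2n}}{t_1t_3\cdots t_{2n-1}}.$$ Further, $v=1$ if and only if the periodic light-like trajectory is stable in the linear approximation.
   Context: In the metric $dx\,dy$ the null (light-like) directions are the horizontal and the vertical ones. A light-like billiard trajectory inside $\gamma$ consists of alternating horizontal and vertical chords of $\gamma$: from a point of $\gamma$ one follows the horizontal (resp. vertical) line to its second intersection with $\gamma$, and so on. At an impact point the velocity vector is decomposed into its component tangent to $\gamma$ and its component normal to $\gamma$ with respect to the metric; the reflection preserves the tangential component and changes the sign of the normal one. At a point where $\gamma$ has slope $t$ the tangent is spanned by $(1,t)$ and the normal by $(1,-t)$; the reflection is defined when the tangent line is not null, so $t$ is finite and non-zero at each $P_i$. The segment from $P_1$ to $P_2$ is horizontal, and the return velocity is taken after the reflection at $P_1$ that closes the cycle (the $2n$-th reflection, after those at $P_2,\dots,P_{2n}$). Stable in the linear approximation means: the width of an infinitesimal parallel beam of null trajectories (horizontal beam around the segment $P_1P_2$) is the same after all $2n$ reflections, to first order; i.e. the derivative of the return map, acting on the transverse coordinate of the beam, equals 1. *)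

(* Defs.v *)
From HB Require Import structures.
From mathcomp Require Import all_boot all_order all_algebra.
From mathcomp Require Import all_classical all_reals all_analysis.

Set Implicit Arguments.
Unset Strict Implicit.
Unset Printing Implicit Defensive.

Import Order.TTheory GRing.Theory Num.Theory.
Import numFieldNormedType.Exports.

Local Open Scope classical_set_scope.
Local Open Scope ring_scope.

Section Curves.
Variable R : realType.
Implicit Types (gamma : R -> R * R) (A B : R * R).

Definition smooth (f : R -> R) : Prop :=
  forall (k : nat) (s : R), derivable (derive1n k f) s 1.

Definition vel gamma (s : R) : R * R :=
  (derive1 (fst \o gamma) s, derive1 (snd \o gamma) s).

(* Whether [w] lies to the left (positive) or right (negative) of [u]. *)
Definition det2 (u w : R * R) : R := u.1 * w.2 - u.2 * w.1.

(* A regular simple closed curve is convex when it lies, for each of its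
   tangent lines, entirely on one side of that line; straight pieces are
   allowed. *)
Definition convex_smooth_closed_curve gamma : Prop :=
  [/\ smooth (fst \o gamma) /\ smooth (snd \o gamma),
      forall s, vel gamma s <> (0, 0),
      exists2 T : R, 0 < T &
        (forall s, gamma (s + T) = gamma s) /\
        (forall s r, 0 <= s < T -> 0 <= r < T -> gamma s = gamma r -> s = r) &
      forall s, (forall r, 0 <= det2 (vel gamma s) (gamma r - gamma s)) \/
                (forall r, det2 (vel gamma s) (gamma r - gamma s) <= 0)].

(* Finite slope: the tangent at [A] is not vertical. *)
Definition has_slope gamma A (t : R) : Prop :=
  exists s, [/\ gamma s = A, (vel gamma s).1 != 0 &
                t = (vel gamma s).2 / (vel gamma s).1].

Definition horizontal_chord A B : Prop := A.2 = B.2 /\ A <> B.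
Definition vertical_chord A B : Prop := A.1 = B.1 /\ A <> B.

(* [m] consecutive chords P 1 P 2, ..., P m P m.+1 of the curve, alternately
   horizontal and vertical, the first one horizontal.  The values of P outside
   1..m.+1 play no role. *)
Definition lightlike_trajectory gamma (m : nat) (P : nat -> R * R) : Prop :=
  (forall i : nat, (1 <= i <= m.+1)%N -> range gamma (P i)) /\
  (forall i : nat, (1 <= i <= m)%N ->
     if odd i then horizontal_chord (P i) (P i.+1)
     else vertical_chord (P i) (P i.+1)).

(* P 1, ..., P m closed up by P m.+1 = P 1. *)
Definition periodic_lightlike_trajectory gamma (m : nat) (P : nat -> R * R)
    : Prop :=
  lightlike_trajectory gamma m P /\ P m.+1 = P 1%N.

(* A parallel beam of horizontal rays around the ray leaving [P 1]: the ray at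
   height [y] starts at the point [Q y 1] of the curve close to [P 1] and makes
   [m] successive chords [Q y 1, ..., Q y m.+1]. *)
Definition horizontal_beam gamma (m : nat) (P : nat -> R * R)
    (Q : R -> nat -> R * R) : Prop :=
  (Q y 1%N @[y --> (P 1%N).2] --> P 1%N) /\
  (\forall y \near (P 1%N).2,
     lightlike_trajectory gamma m (Q y) /\ (Q y 1%N).2 = y).

(* After the reflection at [Q y m.+1] (m even) the ray is again horizontal, so
   [y |-> (Q y m.+1).2] is the return map in the transverse coordinate. *)
Definition linearly_stable gamma (m : nat) (P : nat -> R * R) : Prop :=
  exists Q : R -> nat -> R * R,
    horizontal_beam gamma m P Q /\
    is_derive (P 1%N).2 1 (fun y => (Q y m.+1).2) 1.

End Curves.

Section Reflection.
Variable R : realType.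
Implicit Types u w d : R * R.

(* The polarization of the quadratic form dx dy. *)
Definition lorentz u w : R := (u.1 * w.2 + u.2 * w.1) / 2.

(* Components of [u] along the line spanned by the non-null vector [d] and
   along its Lorentz-orthogonal complement. *)
Definition tangential d u : R * R :=
  (lorentz u d / lorentz d d * d.1, lorentz u d / lorentz d d * d.2).
Definition normal d u : R * R := u - tangential d u.

Definition reflect_at (t : R) u : R * R :=
  tangential (1, t) u - normal (1, t) u.

(* Velocity after starting with [(1, 0)] and reflecting successively at points
   with slopes t 2, ..., t m and finally t 1. *)
Definition return_velocity (m : nat) (t : nat -> R) : R * R :=
  foldl (fun u a => reflect_at a u) (1, 0)
        (rcons [seq t i | i <- iota 2 m.-1] (t 1%N)).

End Reflection.

(* Main.v *)
Require Import Defs.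
From HB Require Import structures.
From mathcomp Require Import all_boot all_order all_algebra.
From mathcomp Require Import all_classical all_reals all_analysis.
From mathcomp Require Import ring lra zify.

Set Implicit Arguments.
Unset Strict Implicit.
Unset Printing Implicit Defensive.

Import Order.TTheory GRing.Theory Num.Theory.
Import numFieldNormedType.Exports.

Local Open Scope classical_set_scope.
Local Open Scope ring_scope.

(** In coordinates where the metric is dx dy, the reflection at a point of slope
    [t] exchanges the two null directions: it sends [(v, 0)] to [(0, v t)] and
    [(0, v)] to [(v / t, 0)] ([reflect_at_orient]).  Going once around the
    trajectory multiplies the speed by the slopes at even points and divides it
    by the slopes at odd points, which is the formula for [v].

    The width of a null beam is multiplied by the inverse factor at each
    impact: a horizontal chord keeps the height, and next to its end point, of
    slope [t], the curve satisfies [dy = t dx], so a height increment [dy]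
    becomes an abscissa increment [dy / t] ([chord_transverse_step]); for
    vertical chords the two coordinates exchange their roles.  Hence the
    derivative of the return map is [1 / v] ([return_map_derivative]), and it is
    [1] exactly when [v] is.

    What needs care is that nearby rays really follow the trajectory: the end
    of a chord starting near [P i] must be near [P i.+1].  Convexity gives this:
    a horizontal line that crosses the curve transversally at two points meets
    it nowhere else ([horizontal_line_two_points]).  So the other end of a chord
    starting near [A] lies on a compact part of the curve whose only point at
    the height of [A] is [B], and its height tends to that of [B]; by
    compactness it tends to [B] ([cvg_compact_fiber], [chord_end_cvg]).  This
    holds for every beam, so the choice of the beam in the definition of
    stability does not matter.  A beam exists because the height is locally onto
    near points of non-zero slope ([horizontal_beam_exists]). *)

(** * Limits and first-order proportionality *)

(** A continuous map is closed on a compact set, so approaching the value at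
    [b] inside [K], where that value is taken only at [b], forces
    approaching [b]. *)
Lemma cvg_compact_fiber (S Y : topologicalType) (K : set S) (h : S -> Y)
    (b : S) (I : Type) (F : set_system I) (FF : Filter F) (Z : I -> S) :
  hausdorff_space Y -> compact K -> continuous h ->
  (forall s, K s -> h s = h b -> s = b) ->
  (\forall x \near F, K (Z x)) -> h (Z x) @[x --> F] --> h b ->
  Z x @[x --> F] --> b.
Proof.
move=> hY cK ch inj KZ hZ V; rewrite nbhsE => -[U [oU Ub] UV].
have cKU : compact (K `\` U).
  rewrite setDE; apply: (compact_closedI cK).
  exact: open_closedC.
have cl : closed (h @` (K `\` U)).
  apply: compact_closed => //; apply: continuous_compact => //.
  exact: continuous_subspaceT.
have nb : nbhs (h b) (~` (h @` (K `\` U))).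
  apply: open_nbhs_nbhs; split; first exact: closed_openC.
  by move=> [s [Ks nUs] hs]; apply: nUs; rewrite (inj s).
have hZ' : \forall x \near F, (~` (h @` (K `\` U))) (h (Z x)) by exact: hZ.
change (\forall x \near F, V (Z x)).
apply: filterS2 hZ' KZ => x /= hZx KZx; apply: UV.
by apply: contrapT => nU; apply: hZx; exists (Z x).
Qed.

Lemma cvg_nbhs_eq (X Y : topologicalType) (f : X -> Y) (a : X) (l : Y) :
  hausdorff_space Y -> f x @[x --> a] --> l -> f a = l.
Proof.
move=> hY fl; apply: hY => A B /nbhs_singleton Afa /fl /nbhs_singleton Bfa.
by exists (f a).
Qed.

Lemma hausdorff_plane (R : realType) : hausdorff_space (R * R)%type.
Proof. exact: norm_hausdorff. Qed.

Section FirstOrder.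
Variables (R : realType) (I : Type) (F : set_system I).
Context {FF : Filter F}.
Implicit Types (u w z : I -> R).

(** Caratheodory's form of [u / w --> c]: it makes sense where [w] vanishes and
    composes without any case distinction. *)
Definition first_order (c : R) u w : Prop :=
  exists2 psi : I -> R, psi x @[x --> F] --> c &
    \forall x \near F, u x = psi x * w x.

Lemma first_order_trans c d u w z :
  first_order c u w -> first_order d w z -> first_order (c * d) u z.
Proof.
move=> [p pc uw] [q qd wz]; exists (fun x => p x * q x); first exact: cvgM.
by apply: filterS2 uw wz => x -> ->; rewrite mulrA.
Qed.

Lemma first_order_sym c u w :
  c != 0 -> first_order c u w -> first_order c^-1 w u.
Proof.
move=> c0 [p pc uw]; exists (fun x => (p x)^-1); first exact: cvgV.
have p0 : \forall x \near F, p x != 0 by apply: cvgr_neq0 pc c0.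
by apply: filterS2 uw p0 => x -> px0; rewrite mulKf.
Qed.

End FirstOrder.

Lemma is_derive_first_order (R : realType) (f : R -> R) (a d : R) :
  is_derive a 1 f d <->
  first_order (nbhs a) d (fun s => f s - f a) (fun s => s - a).
Proof.
rewrite is_derive1_caratheodory; split=> [[g [fE gc <-]]|[psi psid fE]].
  by exists g => //; apply: nearW.
have psia : psi a = d.
  exact: (cvg_nbhs_eq (@norm_hausdorff R R^o) psid).
exists (fun s => if s == a then d else (f s - f a) / (s - a)); split.
- move=> z; case: eqP => [->|/eqP za]; first by rewrite !subrr mulr0.
  by rewrite divfK // subr_eq0.
- rewrite /prop_for /continuous_at eqxx.
  apply: cvg_trans psid; apply: near_eq_cvg.
  apply: filterS fE => s fE; case: eqP => [->|/eqP sa]; first by [].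
  by rewrite fE mulfK // subr_eq0.
- by rewrite eqxx.
Qed.

(** * Local geometry of a convex curve *)

Section Curve.
Variables (R : realType) (gamma : R -> R * R).
Hypothesis hgamma : convex_smooth_closed_curve gamma.

Lemma is_derive_fst (s : R) : is_derive s 1 (fst \o gamma) (vel gamma s).1.
Proof.
case: hgamma => -[sm _] _ _ _; rewrite /vel /= derive1E; apply: derivableP.
exact: (sm 0%N).
Qed.

Lemma is_derive_snd (s : R) : is_derive s 1 (snd \o gamma) (vel gamma s).2.
Proof.
case: hgamma => -[_ sm] _ _ _; rewrite /vel /= derive1E; apply: derivableP.
exact: (sm 0%N).
Qed.

Lemma continuous_fst_curve : continuous (fst \o gamma).
Proof.
move=> s; apply/differentiable_continuous/derivable1_diffP.
by case: (is_derive_fst s).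
Qed.

Lemma continuous_snd_curve : continuous (snd \o gamma).
Proof.
move=> s; apply/differentiable_continuous/derivable1_diffP.
by case: (is_derive_snd s).
Qed.

Lemma continuous_vel_snd : continuous (fun s => (vel gamma s).2).
Proof.
case: hgamma => -[_ sm] _ _ _ s.
exact/differentiable_continuous/derivable1_diffP/(sm 1%N).
Qed.

Lemma continuous_curve : continuous gamma.
Proof.
move=> s; have pair : ((fst \o gamma) r, (snd \o gamma) r) @[r --> s] -->
    ((fst \o gamma) s, (snd \o gamma) s).
  apply: (cvg_pair (FF := nbhs_filter s) (FG := nbhs_filter _) (FH := nbhs_filter _)).
    exact: (@continuous_fst_curve s).
  exact: (@continuous_snd_curve s).
rewrite /continuous_at [gamma s]surjective_pairing.
apply: cvg_trans pair; apply: near_eq_cvg; apply: nearW => r /=.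
exact/esym/surjective_pairing.
Qed.

(** The curve is parametrized by each closed interval of one full period; when
    [a] is its midpoint, it is the only parameter of [gamma a] there. *)
Lemma curve_window a : exists h : R,
  (forall r, exists2 s, s \in `[a - h, a + h] & gamma s = gamma r) /\
  (forall s, s \in `[a - h, a + h] -> gamma s = gamma a -> s = a).
Proof.
case: hgamma => _ _ [T T0 [per inj]] _.
have perz (k : int) s : gamma (s + k%:~R * T) = gamma s.
  have pern (n : nat) r : gamma (r + n%:R * T) = gamma r.
    elim: n => [|n IH]; first by rewrite mul0r addr0.
    by rewrite -natr1 mulrDl mul1r addrA per.
  case: k => n; first exact: pern.
  by rewrite -(pern n.+1) NegzE mulrNz mulNr subrK.
(* The representative of [r] modulo [T] that lies between [b] and [b + T]. *)
pose red b r := r - (Num.floor ((r - b) / T))%:~R * T.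
have redE b r : gamma (red b r) = gamma r.
  by rewrite /red -mulNr -mulrNz perz.
have red_itv b r : b <= red b r < b + T.
  have /andP[] := floor_itv ((r - b) / T); rewrite /red.
  set k := Num.floor _; rewrite ler_pdivlMr // ltr_pdivrMr // intrD mulr1z.
  by rewrite mulrDl mul1r; move: (k%:~R * T) => x; lra.
exists (T / 2); split=> [r|s].
  exists (red (a - T / 2) r) => //=.
  by rewrite in_itv /=; have := red_itv (a - T / 2) r; lra.
rewrite in_itv /= => sa gs.
have /inj : 0 <= red 0 s < T by have := red_itv 0 s; rewrite add0r.
move=> /(_ (red 0 a)); rewrite !redE => /(_ _ gs).
have := red_itv 0 a; rewrite add0r => /[swap] /[apply].
rewrite /red; set k := Num.floor _; set l := Num.floor _ => kl.
have ksl : s - a = (k - l)%:~R * T by rewrite intrB mulrBl; lra.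
have : (k - l)%:~R = (s - a) / T by rewrite ksl mulfK // gt_eqF.
have : `| (s - a) / T | < 1.
  rewrite ltr_norml ltr_pdivlMr // ltr_pdivrMr //; lra.
move=> /[swap] <-; rewrite -intr_norm ltrz1 => kl0.
have kl1 : k - l = 0 by lia.
by move: ksl; rewrite kl1 mul0r => /eqP; rewrite subr_eq0 => /eqP.
Qed.

(** Points of the curve near [gamma a] have parameters near [a]: this turns
    statements about points of the curve into statements about parameters, so
    that derivatives can be used. *)
Lemma curve_lift (I : Type) (F : set_system I) (FF : Filter F)
    (Z : I -> R * R) a :
  Z x @[x --> F] --> gamma a -> (\forall x \near F, range gamma (Z x)) ->
  exists2 sig : I -> R, sig x @[x --> F] --> a &
    \forall x \near F, gamma (sig x) = Z x.
Proof.
move=> Za rZ; have [h [ex inj]] := curve_window a.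
pose sig x := xget a [set s | s \in `[a - h, a + h] /\ gamma s = Z x].
have sigP : \forall x \near F, sig x \in `[a - h, a + h] /\ gamma (sig x) = Z x.
  apply: filterS rZ => x [r _ rZx].
  apply: (@xgetPex _ a [set s | s \in `[a - h, a + h] /\ gamma s = Z x]).
  by have [s sh sr] := ex r; exists s; split => //; rewrite sr.
exists sig; last by apply: filterS sigP => x [].
apply: (@cvg_compact_fiber _ _ `[a - h, a + h]%classic gamma) => //.
- exact: segment_compact.
- exact: continuous_curve.
- by apply: filterS sigP => x [].
- apply: cvg_trans Za; apply: near_eq_cvg.
  by apply: filterS sigP => x [].
Qed.

Lemma compact_curve : compact (range gamma).
Proof.
have [h [ex _]] := curve_window 0.
have -> : range gamma = gamma @` `[0 - h, 0 + h]%classic.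
  apply/seteqP; split=> Z [s sI sZ]; last by exists s.
  by have [r rI rs] := ex s; exists r; rewrite ?rs.
apply: continuous_compact; last exact: segment_compact.
exact/continuous_subspaceT/continuous_curve.
Qed.

(** Both coordinates are proportional, to first order, to the increment of the
    parameter; eliminating the parameter leaves the slope. *)
Lemma curve_slope (I : Type) (F : set_system I) (FF : Filter F)
    (Z : I -> R * R) A t :
  has_slope gamma A t -> Z x @[x --> F] --> A ->
  (\forall x \near F, range gamma (Z x)) ->
  first_order F t (fun x => (Z x).2 - A.2) (fun x => (Z x).1 - A.1).
Proof.
move=> [a [<- f0 ->]] Za rZ.
have [sig siga sigZ] := curve_lift FF Za rZ.
have along (c : R) (f : R -> R) (pr : R * R -> R) : is_derive a 1 f c ->
    (forall s, f s = pr (gamma s)) ->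
    first_order F c (fun x => pr (Z x) - pr (gamma a)) (fun x => sig x - a).
  move=> /is_derive_first_order [psi psic fE] fpr.
  exists (psi \o sig); first exact: cvg_comp siga psic.
  have := siga _ fE => {}fE.
  have {}fE : \forall x \near F,
    f (sig x) - f a = psi (sig x) * (sig x - a) by exact: fE.
  by apply: filterS2 fE sigZ => x; rewrite !fpr => + <-.
apply: first_order_trans (along _ _ snd (is_derive_snd a) _) _ => //.
apply: first_order_sym f0 _.
exact: (along _ _ fst (is_derive_fst a)).
Qed.

(** By Rolle, since the derivative of the height does not vanish near [a]. *)
Lemma curve_locally_injective a : (vel gamma a).2 != 0 ->
  exists2 U, open U /\ U (gamma a) &
    forall X Z, U X -> U Z -> range gamma X -> range gamma Z -> X.2 = Z.2 ->
      X = Z.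
Proof.
move=> g0.
have [e /= e0 ge] : nbhs a (fun s => (vel gamma s).2 != 0).
  exact: (cvgr_neq0 _ (@continuous_vel_snd a) g0).
have [sig siga sigZ] := @curve_lift _ (within (range gamma) (nbhs (gamma a)))
  _ id a (cvg_within _) (near_withinT _ _).
have /siga sige : nbhs a (ball a e) by exact: nbhsx_ballx.
have : nbhs (gamma a) [set Z | range gamma Z ->
    ball a e (sig Z) /\ gamma (sig Z) = Z].
  have sige' : \forall x \near within (range gamma) (nbhs (gamma a)),
     ball a e (sig x) by exact: sige.
  rewrite !near_withinE in sigZ sige'.
  by apply: filterS2 sigZ sige' => Z gs es rZ; split; [exact: es|exact: gs].
rewrite nbhsE => -[U [oU Ua] Usub]; exists U => // X Z UX UZ rX rZ XZ.
have [Xe gX] := Usub X UX rX; have [Ze gZ] := Usub Z UZ rZ.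
suff ltF s r : ball a e s -> ball a e r ->
    (gamma s).2 = (gamma r).2 -> ~ s < r.
  rewrite -gX -gZ; congr gamma.
  case: (ltgtP (sig X) (sig Z)) => // lt; exfalso; move: lt.
    by apply: ltF => //; rewrite gX gZ.
  by apply: ltF => //; rewrite gX gZ.
move=> se re gsr sr.
have [||c] := @Rolle R (snd \o gamma) s r sr _ _ gsr.
- by move=> x _; case: (is_derive_snd x).
- exact/continuous_subspaceT/continuous_snd_curve.
- rewrite in_itv /= => /andP[sc cr] [_ gc].
  have : (vel gamma c).2 != 0.
    apply: ge; move: se re; rewrite /ball /= !ltr_norml; lra.
  by rewrite /vel /= derive1E gc eqxx.
Qed.

(** By the intermediate value theorem: as its derivative does not vanish, the
    height takes values on both sides of [(gamma b).2] arbitrarily close to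
    [b]. *)
Lemma curve_height_surjective b V : (vel gamma b).2 != 0 ->
  nbhs (gamma b) V ->
  \forall y \near (gamma b).2, exists2 Z, range gamma Z /\ V Z & Z.2 = y.
Proof.
move=> g0 nV.
have [psi psib gE] := (is_derive_first_order _ _ _).1 (is_derive_snd b).
have Vb : nbhs b (gamma @^-1` V) by exact: continuous_curve.
have pos : \forall s \near b, 0 < psi s * (vel gamma b).2.
  have : psi s * (vel gamma b).2 @[s --> b] --> (vel gamma b).2 ^+ 2.
    by rewrite expr2; apply: cvgM => //; exact: cvg_cst.
  move=> /cvgr_gt; apply; by rewrite exprn_even_gt0.
have [e /= e0 be] : nbhs b (fun s => [/\ V (gamma s), 0 < psi s * (vel gamma b).2 &
   (gamma s).2 - (gamma b).2 = psi s * (s - b)]).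
  by apply: filterS3 Vb pos gE.
pose d := e / 2; have d0 : 0 < d by rewrite divr_gt0.
have inb s : s \in `[b - d, b + d] -> ball b e s.
  by rewrite in_itv /= /ball /= ltr_norml /d; lra.
have [_ p1 g1] : [/\ V (gamma (b - d)), 0 < psi (b - d) * (vel gamma b).2 & 
   (gamma (b - d)).2 - (gamma b).2 = psi (b - d) * (b - d - b)].
  by apply: be; apply: inb; rewrite in_itv /=; lra.
have [_ p2 g2] : [/\ V (gamma (b + d)), 0 < psi (b + d) * (vel gamma b).2 & 
   (gamma (b + d)).2 - (gamma b).2 = psi (b + d) * (b + d - b)].
  by apply: be; apply: inb; rewrite in_itv /=; lra.
pose lo := Num.min (gamma (b - d)).2 (gamma (b + d)).2.
pose hi := Num.max (gamma (b - d)).2 (gamma (b + d)).2.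
have lohi : lo < (gamma b).2 < hi.
  rewrite /lo /hi gt_min lt_max.
  move: g0; rewrite neq_lt => /orP[] g0.
  - rewrite !nmulr_lgt0 // in p1 p2.
    apply/andP; split; apply/orP; [right|left]; nra.
  - rewrite !pmulr_lgt0 // in p1 p2.
    apply/andP; split; apply/orP; [left|right]; nra.
have : \forall y \near (gamma b).2, lo < y < hi.
  case/andP: lohi => lo1 hi1.
  near=> y; apply/andP; split; near: y; [exact: lt_nbhsr|exact: lt_nbhsl].
apply: filterS => y /andP[y1 y2].
have [||| c cI cy] := @IVT R (snd \o gamma) (b - d) (b + d) y.
- by lra.
- exact/continuous_subspaceT/continuous_snd_curve.
- by apply/andP; split; exact: ltW.
- exists (gamma c) => //; split; first by exists c.
  by have [] := be c (inb c cI).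
Unshelve. all: by end_near. Qed.

(** Of three points at the same height, consider the middle one.  If the tangent
    there is not horizontal, it separates the two others.  If it is
    horizontal, the middle point is a third point [C], the line is a supporting
    line of the curve, and the height is extremal at [gamma a], against
    transversality. *)
Lemma horizontal_line_two_points a b C : (vel gamma a).2 != 0 ->
  (vel gamma b).2 != 0 -> horizontal_chord (gamma a) (gamma b) ->
  range gamma C -> C.2 = (gamma a).2 -> C = gamma a \/ C = gamma b.
Proof.
move=> ga0 gb0 [ab nab] [c _ <-] ca.
case: hgamma => _ reg _ conv.
(* A tangent that is not horizontal separates [gamma p] from [gamma r]. *)
have midF p q r : (vel gamma q).2 != 0 -> (gamma p).2 = (gamma q).2 ->
    (gamma r).2 = (gamma q).2 -> (gamma p).1 < (gamma q).1 ->
    (gamma q).1 < (gamma r).1 -> False.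
  move=> q0 pq rq lpq lqr.
  have detE u z : (gamma z).2 = (gamma q).2 ->
      det2 u (gamma z - gamma q) = u.2 * ((gamma q).1 - (gamma z).1).
    by move=> zq; rewrite /det2 /= zq; ring.
  by have [H|H] := conv q; have := H p; have := H r; rewrite !detE //;
    move: (vel gamma q) q0 => [u1 u] /=; rewrite neq_lt => /orP[] u0; nra.
have gc0 : (vel gamma c).2 != 0.
  apply/eqP => gc0.
  have fc0 : (vel gamma c).1 != 0.
    apply/eqP => fc0; apply: (reg c).
    by rewrite [vel _ _]surjective_pairing gc0 fc0.
  have extr : (forall r, (gamma a).2 <= (gamma r).2) \/
              (forall r, (gamma r).2 <= (gamma a).2).
    move: (conv c) gc0 fc0; rewrite /det2; case: (vel gamma c) => u1 u2 /= H u20.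
    rewrite neq_lt => /orP[] u0.
    - by case: H => H; [right|left] => r; have := H r; rewrite u20 ca; nra.
    - by case: H => H; [left|right] => r; have := H r; rewrite u20 ca; nra.
  have aI : a \in `]a - 1, a + 1[ by rewrite in_itv /=; lra.
  have aa : a - 1 <= a + 1 by lra.
  have dg x : x \in `]a - 1, a + 1[ -> derivable (snd \o gamma) x 1.
    by case: (is_derive_snd x).
  have [H|H] := extr.
    have [_ ga] := @derive1_at_min _ _ _ _ a aa dg aI (fun x _ => H x).
    by move: ga0; rewrite /vel /= derive1E ga eqxx.
  have [_ ga] := @derive1_at_max _ _ _ _ a aa dg aI (fun x _ => H x).
  by move: ga0; rewrite /vel /= derive1E ga eqxx.
have ext p q : (gamma p).2 = (gamma q).2 -> (gamma p).1 = (gamma q).1 ->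
    gamma p = gamma q.
  by move=> e2 e1; rewrite [LHS]surjective_pairing e1 e2 -surjective_pairing.
case: (ltgtP (gamma c).1 (gamma a).1) => [xca|xca|xca]; last by left; exact: ext.
- case: (ltgtP (gamma c).1 (gamma b).1) => [xcb|xcb|xcb].
  + case: (ltgtP (gamma a).1 (gamma b).1) => [xab|xab|xab].
    * by exfalso; apply: (midF c a b) => //; congruence.
    * by exfalso; apply: (midF c b a) => //; congruence.
    * by case: nab; exact: ext.
  + by exfalso; apply: (midF b c a) => //; congruence.
  + by right; apply: ext; congruence.
- case: (ltgtP (gamma c).1 (gamma b).1) => [xcb|xcb|xcb].
  + by exfalso; apply: (midF a c b) => //; congruence.
  + case: (ltgtP (gamma a).1 (gamma b).1) => [xab|xab|xab].
    * by exfalso; apply: (midF a b c) => //; congruence.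
    * by exfalso; apply: (midF b a c) => //; congruence.
    * by case: nab; exact: ext.
  + by right; apply: ext; congruence.
Qed.

End Curve.

(** * Chords with moving end points *)

Section Chords.
Variables (R : realType) (gamma : R -> R * R).
Hypothesis hgamma : convex_smooth_closed_curve gamma.
Variables (I : Type) (F : set_system I).
Context {FF : Filter F}.
Variables (A B : R * R) (tA tB : R).
Hypotheses (slopeA : has_slope gamma A tA) (tA0 : tA != 0).
Hypotheses (slopeB : has_slope gamma B tB) (tB0 : tB != 0).
Hypothesis AB : horizontal_chord A B.

Lemma has_slope_transversal C t : has_slope gamma C t -> t != 0 ->
  exists2 c, gamma c = C & (vel gamma c).2 != 0.
Proof.
move=> [c [cC _ ->]]; rewrite mulf_eq0 negb_or => /andP[? _].
by exists c.
Qed.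

Lemma cvg_snd_plane (X : I -> R * R) (C : R * R) :
  X x @[x --> F] --> C -> (X x).2 @[x --> F] --> C.2.
Proof. by move=> XC; apply: cvg_comp XC _; exact: cvg_snd. Qed.

(** The height is onto already on the part of the curve near [B], which is
    disjoint from a neighborhood of [A] and hence does not contain the starting
    point. *)
Lemma near_chord_exists (X : I -> R * R) : X x @[x --> F] --> A ->
  \forall x \near F, exists Z, range gamma Z /\ horizontal_chord (X x) Z.
Proof.
move=> XA; have [b bB gb0] := has_slope_transversal slopeB tB0.
have := @hausdorff_plane R; rewrite open_hausdorff => /(_ A B).
have nAB : A != B by apply/eqP; case: AB.
move=> /(_ nAB) [[U V] /= [/set_mem UA /set_mem VB] [oU oV /eqP UV0]].
have nV : nbhs (gamma b) V by rewrite bB; exact: open_nbhs_nbhs.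
have nU : nbhs A U by exact: open_nbhs_nbhs.
have sur := curve_height_surjective hgamma gb0 nV.
have XU : \forall x \near F, U (X x) by exact: XA.
have Xsur : \forall x \near F, exists2 Z, range gamma Z /\ V Z & Z.2 = (X x).2.
  by move: sur; rewrite bB; case: AB => <- _; exact: (cvg_snd_plane XA).
apply: filterS2 XU Xsur => x UX [Z [rZ VZ] ZX].
exists Z; split=> //; split; first by rewrite ZX.
move=> XZ; have : (U `&` V) Z by split; rewrite // -XZ.
by rewrite UV0.
Qed.

(** The height determines the points of the curve outside a neighborhood of [A]:
    among them only [B] is at the height of [A]. *)
Lemma cvg_other_end (U : set (R * R)) (Z : I -> R * R) : open U -> U A ->
  (\forall x \near F, (range gamma `\` U) (Z x)) ->
  (Z x).2 @[x --> F] --> B.2 -> Z x @[x --> F] --> B.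
Proof.
move=> oU UA rZ ZB2.
have [a aA ga0] := has_slope_transversal slopeA tA0.
have [b bB gb0] := has_slope_transversal slopeB tB0.
apply: (@cvg_compact_fiber _ _ (range gamma `\` U) (snd : R * R -> R)) => //.
- rewrite setDE; apply: compact_closedI; first exact: compact_curve.
  exact: open_closedC.
- by move=> C; exact: cvg_snd.
- move=> C [rC nUC] CB.
  have [||E|//] := @horizontal_line_two_points _ _ hgamma a b C ga0 gb0 _ rC.
  + by rewrite aA bB.
  + by rewrite aA CB; case: AB.
  + by case: nUC; rewrite E aA.
  + by rewrite bB.
Qed.

(** The end point cannot linger near [A]: the curve has only one point at each
    height there, namely the starting point of the chord. *)
Lemma chord_end_cvg (X Z : I -> R * R) : X x @[x --> F] --> A ->
  (\forall x \near F, range gamma (X x)) ->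
  (\forall x \near F, range gamma (Z x)) ->
  (\forall x \near F, horizontal_chord (X x) (Z x)) ->
  Z x @[x --> F] --> B.
Proof.
move=> XA rX rZ XZ.
have [a aA ga0] := has_slope_transversal slopeA tA0.
have [U [oU Ua] injU] := curve_locally_injective hgamma ga0.
apply: (@cvg_other_end U) => //; first by rewrite -aA.
- have XU : \forall x \near F, U (X x).
    have nU : nbhs A U by rewrite -aA; exact: open_nbhs_nbhs.
    exact: XA.
  apply: filterS2 (filterI XU XZ) (filterI rX rZ).
  move=> x [UX [XZ2 nXZ]] [rXx rZx]; split=> // UZ.
  by apply: nXZ; apply: injU.
- have := cvg_snd_plane XA; have -> : A.2 = B.2 by case: AB.
  apply: cvg_trans.
  by apply: near_eq_cvg; apply: filterS XZ => x [].
Qed.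

Lemma chord_transverse_step (X Z : I -> R * R) (w : I -> R) c :
  X x @[x --> F] --> A ->
  (\forall x \near F, range gamma (X x)) ->
  (\forall x \near F, range gamma (Z x)) ->
  (\forall x \near F, horizontal_chord (X x) (Z x)) ->
  first_order F c (fun x => (X x).2 - A.2) w ->
  first_order F (tB^-1 * c) (fun x => (Z x).1 - B.1) w.
Proof.
move=> XA rX rZ XZ [psi psic Xw].
have ZB := chord_end_cvg XA rX rZ XZ.
apply: first_order_trans.
  exact/first_order_sym/(curve_slope hgamma FF slopeB ZB rZ).
exists psi => //; apply: filterS2 XZ Xw => x [<- _] <-.
by case: AB => ->.
Qed.

End Chords.

Section BeamStart.
Variables (R : realType) (gamma : R -> R * R).
Hypothesis hgamma : convex_smooth_closed_curve gamma.

(** The chord from [A] to [B] serves to single out [A] among the points of the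
    curve at its height. *)
Lemma beam_start (A B : R * R) (tA tB : R) :
  has_slope gamma A tA -> tA != 0 -> has_slope gamma B tB -> tB != 0 ->
  horizontal_chord A B ->
  exists X : R -> R * R, X y @[y --> A.2] --> A /\
    \forall y \near A.2, range gamma (X y) /\ (X y).2 = y.
Proof.
move=> sA tA0 sB tB0 AB.
have [a aA ga0] := has_slope_transversal sA tA0.
have := @hausdorff_plane R; rewrite open_hausdorff => /(_ A B).
have nAB : A != B by apply/eqP; case: AB.
move=> /(_ nAB) [[V W] /= [/set_mem VA /set_mem WB] [oV oW /eqP VW0]].
have nV : nbhs (gamma a) V by rewrite aA; exact: open_nbhs_nbhs.
have := curve_height_surjective hgamma ga0 nV; rewrite aA => sur.
pose X y := xget A [set Z | (range gamma Z /\ V Z) /\ Z.2 = y].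
have XP : \forall y \near A.2, (range gamma (X y) /\ V (X y)) /\ (X y).2 = y.
  apply: filterS sur => y [Z rZ Zy].
  by apply: (@xgetPex _ A [set Z | (range gamma Z /\ V Z) /\ Z.2 = y]); exists Z.
exists X; split; last by apply: filterS XP => y [[]].
have BA : horizontal_chord B A by case: AB => E nE; split=> // /esym.
apply: (cvg_other_end hgamma sB tB0 sA tA0 BA oW WB).
- apply: filterS XP => y [[rX VX] _]; split=> // WX.
  by have : (V `&` W) (X y) by []; rewrite VW0.
- have idA : y @[y --> A.2] --> A.2 by exact: cvg_id.
  apply: cvg_trans idA; apply: near_eq_cvg.
  by apply: filterS XP => y [].
Qed.

End BeamStart.

(** * Exchanging horizontal and vertical *)

Section Orientation.
Variable R : realType.
Implicit Types (gamma : R -> R * R) (A B Z : R * R) (b : bool).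

(** Composing with [orient false] makes vertical chords horizontal, so that
    everything needs to be proved for horizontal chords only. *)
Definition orient b Z : R * R := if b then Z else (Z.2, Z.1).

Lemma orientK b : involutive (orient b).
Proof. by case: b => -[]. Qed.

Lemma convex_orient b gamma : convex_smooth_closed_curve gamma ->
  convex_smooth_closed_curve (orient b \o gamma).
Proof.
case: b => // -[[s1 s2] reg [T T0 [per inj]] conv]; split=> //.
- by move=> s [e1 e2]; apply: (reg s); congr pair.
- exists T => //; split=> [s|s r sT rT [e2 e1]]; first by rewrite /= per.
  by apply: inj; rewrite // [LHS]surjective_pairing e1 e2 -surjective_pairing.
- move=> s; have detE r : det2 (vel (orient false \o gamma) s)
      ((orient false \o gamma) r - (orient false \o gamma) s) =
      - det2 (vel gamma s) (gamma r - gamma s).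
    by rewrite /det2 /= opprB.
  case: (conv s) => H; [right|left] => r; rewrite detE.
    by rewrite oppr_le0.
  by rewrite oppr_ge0.
Qed.

Lemma has_slope_orient b gamma A t : t != 0 -> has_slope gamma A t ->
  has_slope (orient b \o gamma) (orient b A) (if b then t else t^-1).
Proof.
case: b => // t0 [s [<- f0 tE]]; exists s; split=> //=.
  by move: t0; rewrite tE mulf_eq0 negb_or => /andP[].
by rewrite tE invf_div.
Qed.

Lemma range_orient b gamma Z :
  range (orient b \o gamma) (orient b Z) <-> range gamma Z.
Proof.
split=> [[s _ /= /(can_inj (@orientK b)) <-]|[s _ <-]]; by exists s.
Qed.

Lemma cvg_orient b (I : Type) (F : set_system I) (FF : Filter F)
    (X : I -> R * R) A :
  X x @[x --> F] --> A -> orient b (X x) @[x --> F] --> orient b A.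
Proof.
case: b => // XA; apply: (cvg_pair (FF := FF) (FG := nbhs_filter _)
  (FH := nbhs_filter _)); apply: cvg_comp XA _; [exact: cvg_snd|exact: cvg_fst].
Qed.

Definition null_chord (i : nat) A B : Prop :=
  if odd i then horizontal_chord A B else vertical_chord A B.

Lemma null_chord_orient i A B : null_chord i A B <->
  horizontal_chord (orient (odd i) A) (orient (odd i) B).
Proof.
rewrite /null_chord; case: (odd i) => //.
by split=> -[AB nAB]; split=> // E; apply: nAB;
  [apply: (can_inj (@orientK false)) | rewrite E].
Qed.

(** By this factor the speed is multiplied, and the width of a beam divided, at
    the impact at [P j]: the ball arrives there horizontally when [j] is even
    and vertically when [j] is odd. *)
Definition slope_factor (t : nat -> R) (j : nat) : R :=
  if odd j then (t j)^-1 else t j.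

End Orientation.

(** * Beams of null trajectories *)

Section Beam.
Variables (R : realType) (gamma : R -> R * R) (P : nat -> R * R) (t : nat -> R).
Hypothesis hgamma : convex_smooth_closed_curve gamma.
Variables (I : Type) (F : set_system I).
Context {FF : Filter F}.

Lemma slope_factor_neq0 j : t j != 0 -> slope_factor t j != 0.
Proof. by rewrite /slope_factor; case: odd; rewrite ?invr_eq0. Qed.

Lemma has_slope_chord_start i : t i != 0 -> has_slope gamma (P i) (t i) ->
  has_slope (orient (odd i) \o gamma) (orient (odd i) (P i)) (slope_factor t i)^-1.
Proof.
move=> ti /(has_slope_orient (odd i) ti).
by rewrite /slope_factor; case: odd => //; rewrite invrK.
Qed.

Lemma has_slope_chord_end i : t i.+1 != 0 ->
  has_slope gamma (P i.+1) (t i.+1) ->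
  has_slope (orient (odd i) \o gamma) (orient (odd i) (P i.+1))
    (slope_factor t i.+1).
Proof.
move=> ti /(has_slope_orient (odd i) ti).
by rewrite /slope_factor /=; case: odd.
Qed.

(** After [i] chords the relevant transverse coordinate is the second one of the
    plane oriented along the next chord; since orientations alternate, it is
    the first one of the plane oriented along the chord just travelled. *)
Lemma beam_follows m (X : I -> nat -> R * R) :
  (forall i, (1 <= i <= m.+1)%N -> has_slope gamma (P i) (t i) /\ t i != 0) ->
  lightlike_trajectory gamma m P ->
  (\forall x \near F, lightlike_trajectory gamma m (X x)) ->
  X x 1%N @[x --> F] --> P 1%N ->
  forall i, (i <= m)%N ->
    X x i.+1 @[x --> F] --> P i.+1 /\
    first_order F (\prod_(2 <= j < i.+2) slope_factor t j)^-1
      (fun x => (orient (odd i.+1) (X x i.+1)).2 - (orient (odd i.+1) (P i.+1)).2)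
      (fun x => (X x 1%N).2 - (P 1%N).2).
Proof.
move=> ht [_ chP] trX X1; elim=> [_|i IH im].
  split=> //; rewrite big_geq // invr1; exists (fun=> 1); first exact: cvg_cst.
  by apply: nearW => x; rewrite mul1r.
have {IH} [Xi wi] := IH (ltnW im).
have [si ti] := ht i.+1 (leqW im : (1 <= i.+1 <= m.+1)%N).
have [sj tj] := ht i.+2 (im : (1 <= i.+2 <= m.+1)%N).
have /null_chord_orient chPi := chP i.+1 (im : (1 <= i.+1 <= m)%N).
pose b := odd i.+1.
have rX k : (k < m.+1)%N ->
    \forall x \near F, range (orient b \o gamma) (orient b (X x k.+1)).
  by move=> km; apply: filterS trX => x [rX _]; apply/range_orient/rX.
have chX : \forall x \near F,
    horizontal_chord (orient b (X x i.+1)) (orient b (X x i.+2)).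
  apply: filterS trX => x [_ /(_ i.+1 (im : (1 <= i.+1 <= m)%N))].
  by move/(null_chord_orient i.+1).
have sA := has_slope_chord_start ti si.
have sB := has_slope_chord_end tj sj.
have hb := convex_orient b hgamma.
have rXi := rX i (leqW im); have rXj := rX i.+1 im.
have Xb := cvg_orient (b := b) FF Xi.
have sA0 : (slope_factor t i.+1)^-1 != 0 by rewrite invr_eq0 slope_factor_neq0.
have sB0 : slope_factor t i.+2 != 0 by rewrite slope_factor_neq0.
split.
  have Zb := chord_end_cvg (FF := FF) hb sA sA0 sB sB0 chPi Xb rXi rXj chX.
  have := cvg_orient (b := b) FF Zb; rewrite orientK; apply: cvg_trans.
  by apply: near_eq_cvg; apply: nearW => x; rewrite orientK.
rewrite big_nat_recr //= invfM mulrC.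
have := chord_transverse_step (FF := FF) hb sA sA0 sB sB0 chPi Xb rXi rXj chX wi.
by rewrite /b /=; case: (odd i).
Qed.

(** Chords are chosen one at a time: the next one exists only for rays that are
    already known to stay close to the trajectory. *)
Lemma beam_exists m (X1 : I -> R * R) :
  (forall i, (1 <= i <= m.+1)%N -> has_slope gamma (P i) (t i) /\ t i != 0) ->
  lightlike_trajectory gamma m P ->
  X1 x @[x --> F] --> P 1%N -> (\forall x \near F, range gamma (X1 x)) ->
  exists2 X : I -> nat -> R * R, (fun x => X x 1%N) = X1 &
    \forall x \near F, lightlike_trajectory gamma m (X x).
Proof.
move=> + + X1P rX1; elim: m => [|m IH] ht [rP chP].
  exists (fun x _ => X1 x) => //; apply: filterS rX1 => x rx.
  by split=> // i /andP[i1 i0]; move: (leq_trans i1 i0).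
have sub k : (1 <= k <= m.+1)%N -> (1 <= k <= m.+2)%N.
  by move=> /andP[-> /= /leqW].
have subm k : (1 <= k <= m)%N -> (1 <= k <= m.+1)%N.
  by move=> /andP[-> /= /leqW].
have trP : lightlike_trajectory gamma m P.
  by split=> k km; [exact/rP/sub | exact/chP/subm].
have htm k : (1 <= k <= m.+1)%N -> has_slope gamma (P k) (t k) /\ t k != 0.
  by move=> km; exact/ht/sub.
have [X XX1 trX] := IH htm trP.
have XP : X x 1%N @[x --> F] --> P 1%N by rewrite XX1.
have [Xm _] := beam_follows htm trP trX XP (leqnn m).
have mm : (1 <= m.+1 <= m.+1)%N by rewrite leqnn.
have [sm tm] := htm _ mm.
have mm2 : (1 <= m.+2 <= m.+2)%N by rewrite leqnn.
have [sm2 tm2] := ht _ mm2.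
have /null_chord_orient chm := chP _ mm.
have nxt := near_chord_exists (FF := FF) (convex_orient (odd m.+1) hgamma)
  (has_slope_chord_end tm2 sm2) (slope_factor_neq0 tm2) chm
  (cvg_orient (b := odd m.+1) FF Xm).
pose next x := [set Z | range gamma Z /\ null_chord m.+1 (X x m.+1) Z].
pose Y x k := if (k <= m.+1)%N then X x k else xget (0, 0) (next x).
exists Y; first by rewrite -XX1.
have nextY : \forall x \near F, next x (Y x m.+2).
  apply: filterS nxt => x [Z [rZ chZ]]; rewrite /Y ltnn.
  apply: xgetPex; exists (orient (odd m.+1) Z); split.
    by apply/(range_orient (odd m.+1)); rewrite orientK.
  by apply/null_chord_orient; rewrite orientK.
apply: filterS2 trX nextY => x [rX chX] [rY chY]; split=> k /andP[k1].
  rewrite leq_eqVlt => /orP[/eqP -> //|km].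
  by rewrite /Y -ltnS km; apply: rX; rewrite k1.
rewrite leq_eqVlt => /orP[/eqP ->|km].
  by move: chY; rewrite /null_chord /Y leqnn ltnn.
have := chX k; rewrite k1 -ltnS km => /(_ isT).
by rewrite /Y (ltnW km) km.
Qed.

End Beam.

(** * The return velocity *)

Section Velocity.
Variable R : realType.
Implicit Types (t : nat -> R).

Lemma reflect_at_orient (a v : R) b : a != 0 ->
  reflect_at a (orient b (v, 0)) =
  orient (~~ b) (v * (if b then a else a^-1), 0).
Proof.
move=> a0; rewrite [LHS]surjective_pairing /reflect_at /normal /tangential.
have aa0 : a + a != 0 by rewrite -mulr2n mulrn_eq0.
by rewrite /lorentz; case: b; congr pair => /=; field; rewrite ?a0.
Qed.

Lemma iota_rcons i k : iota i k.+1 = rcons (iota i k) (i + k)%N.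
Proof. by rewrite -addn1 iotaD cats1. Qed.

Lemma foldl_reflect t k : (forall j, (2 <= j < k.+2)%N -> t j != 0) ->
  foldl (fun u a => reflect_at a u) (1, 0) [seq t i | i <- iota 2 k] =
  orient (odd k.+1) (\prod_(2 <= j < k.+2) slope_factor t j, 0).
Proof.
elim: k => [_|k IH t0]; first by rewrite big_geq.
rewrite iota_rcons map_rcons foldl_rcons IH; last first.
  by move=> j /andP[j2 jk]; apply: t0; rewrite j2 ltnW.
have tk : t k.+2 != 0 by apply: t0; rewrite /= leqnn.
rewrite add2n reflect_at_orient // [in RHS]big_nat_recr //=.
by rewrite /slope_factor /=; case: (odd k).
Qed.

Lemma prod_slope_factor t n :
  \prod_(2 <= j < (2 * n).+2) slope_factor t j =
  (\prod_(1 <= k < n.+1) t (2 * k)%N) /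
  (\prod_(1 <= k < n.+1) t (2 * k).+1).
Proof.
elim: n => [|n IH]; first by rewrite muln0 !big_geq // divr1.
rewrite mulnS add2n 2?[in LHS]big_nat_recr //= IH.
rewrite [\prod_(1 <= k < n.+2) t (2 * k)%N]big_nat_recr //=.
rewrite [\prod_(1 <= k < n.+2) t (2 * k).+1]big_nat_recr //=.
rewrite /slope_factor /= oddM /= invfM mulnS add2n -!mulrA; congr (_ * _).
by rewrite mulrCA; congr (_ * _); rewrite mulrC.
Qed.

Lemma prod_odd_rotate t n : (0 < n)%N -> t (2 * n).+1 = t 1%N ->
  \prod_(1 <= k < n.+1) t (2 * k).+1 = \prod_(1 <= k < n.+1) t (2 * k - 1)%N.
Proof.
move=> n0 tn; rewrite [RHS]big_ltn // big_nat_recr //= tn mulrC; congr (_ * _).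
rewrite [RHS]big_add1 /=; apply: eq_bigr => k _.
by congr t; lia.
Qed.

End Velocity.

(** * The return map *)

Section ReturnMap.
Variables (R : realType) (gamma : R -> R * R) (P : nat -> R * R) (t : nat -> R).
Hypothesis hgamma : convex_smooth_closed_curve gamma.

Lemma return_map_derivative m (Q : R -> nat -> R * R) :
  ~~ odd m ->
  (forall i, (1 <= i <= m.+1)%N -> has_slope gamma (P i) (t i) /\ t i != 0) ->
  lightlike_trajectory gamma m P -> horizontal_beam gamma m P Q ->
  is_derive (P 1%N).2 1 (fun y => (Q y m.+1).2)
    (\prod_(2 <= j < m.+2) slope_factor t j)^-1.
Proof.
move=> evm ht trP [Q1 nQ].
have trQ : \forall y \near (P 1%N).2, lightlike_trajectory gamma m (Q y).
  by apply: filterS nQ => y [].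
have [QP [psi psic Qw]] := beam_follows hgamma ht trP trQ Q1 (leqnn m).
have QE : Q (P 1%N).2 m.+1 = P m.+1 by exact: (cvg_nbhs_eq (@hausdorff_plane R) QP).
apply/is_derive_first_order; exists psi => //.
by apply: filterS2 Qw nQ => y /=; rewrite evm /= QE => -> [_ ->].
Qed.

Lemma horizontal_beam_exists m : (0 < m)%N ->
  (forall i, (1 <= i <= m.+1)%N -> has_slope gamma (P i) (t i) /\ t i != 0) ->
  lightlike_trajectory gamma m P -> exists Q, horizontal_beam gamma m P Q.
Proof.
move=> m0 ht trP.
have [s1 t1] := ht 1%N isT; have [s2 t2] := ht 2%N (m0 : (1 <= 2 <= m.+1)%N).
have ch : horizontal_chord (P 1%N) (P 2%N) by case: trP => _ /(_ 1%N m0).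
have [X1 [X1P nX1]] := beam_start hgamma s1 t1 s2 t2 ch.
have rX1 : \forall y \near (P 1%N).2, range gamma (X1 y).
  by apply: filterS nX1 => y [].
have [X XX1 trX] := beam_exists hgamma ht trP X1P rX1.
have XE y : X y 1%N = X1 y by rewrite -XX1.
exists X; split; first by rewrite XX1.
by apply: filterS2 trX nX1 => y ? []; rewrite XE.
Qed.

End ReturnMap.

Theorem lemma4p2 (R : realType) (gamma : R -> R * R) (n : nat)
    (P : nat -> R * R) (t : nat -> R)
    (hgamma : convex_smooth_closed_curve gamma)
    (hn : (0 < n)%N)
    (hP : periodic_lightlike_trajectory gamma (2 * n) P)
    (ht : forall i : nat, (1 <= i <= 2 * n)%N ->
            has_slope gamma (P i) (t i) /\ t i != 0) :
  exists v : R,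
    [/\ return_velocity (2 * n) t = (v, 0),
        v = (\prod_(1 <= k < n.+1) t (2 * k)%N) /
            (\prod_(1 <= k < n.+1) t (2 * k - 1)%N) &
        v = 1 <-> linearly_stable gamma (2 * n) P].
Proof.
case: hP => trP Pper.
(* The closing reflection at [P 1] is indexed by [2 * n + 1]. *)
have [tau tauE tau_last] : exists2 tau : nat -> R,
    forall j, (j <= 2 * n)%N -> tau j = t j & tau (2 * n).+1 = t 1%N.
  exists (fun j => if j == (2 * n).+1 then t 1%N else t j); last by rewrite eqxx.
  by move=> j jn; case: eqP => // E; move: jn; rewrite E ltnn.
have n2 : (0 < 2 * n)%N by rewrite muln_gt0.
have htau i : (1 <= i <= (2 * n).+1)%N ->
    has_slope gamma (P i) (tau i) /\ tau i != 0.
  move=> /andP[i1]; rewrite leq_eqVlt => /orP[/eqP ->|i2].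
    by rewrite Pper tau_last; apply: ht; rewrite n2.
  by rewrite tauE //; apply: ht; rewrite i1.
pose v := \prod_(2 <= j < (2 * n).+2) slope_factor tau j.
have evn : ~~ odd (2 * n) by rewrite oddM.
have velE : return_velocity (2 * n) t = (v, 0).
  have -> : (v, 0) = orient (odd (2 * n).+1) (v, 0) by rewrite /= evn.
  rewrite -foldl_reflect => [|j /andP[/ltnW j1 jn]]; last first.
    by case: (htau j) => //; rewrite j1.
  rewrite /return_velocity; congr foldl.
  case: (2 * n)%N n2 tauE tau_last => // m _ tauE tau_last.
  rewrite iota_rcons map_rcons add2n tau_last; congr rcons.
  apply/eq_in_map => j; rewrite mem_iota /= => /andP[_ jm].
  by rewrite tauE //; lia.
exists v; split=> //.
  rewrite /v prod_slope_factor prod_odd_rotate //; last by rewrite tau_last tauE.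
  by congr (_ / _); apply: eq_big_nat => k /andP[k1 kn]; rewrite tauE //; lia.
split=> [v1|[Q [hQ dQ]]].
  have [Q hQ] := horizontal_beam_exists hgamma n2 htau trP.
  exists Q; split => //.
  have := return_map_derivative hgamma evn htau trP hQ.
  by rewrite -/v v1 invr1.
have [_ dv] := return_map_derivative hgamma evn htau trP hQ.
case: dQ => _; rewrite dv -/v => v1.
by rewrite -[v]invrK v1 invr1.
Qed.
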